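(* For every $n, d \in \mathbb{N}$ with $n \ge 7$ and $3 \le d \le n-3$, there exists an $(n,d)$-HSF $f_{n,d}$ with $\mathbf{D}[f_{n,d}] \in \left(1 + \Omega\left(n^{-1} e^{-d^2/n}\right)\right)\mathbf{D}[f^*_{n,d}]$, i.e. there is an absolute constant $c>0$ such that $\mathbf{D}[f_{n,d}] \ge \left(1 + c\, n^{-1}e^{-d^2/n}\right)\mathbf{D}[f^*_{n,d}]$ for all such $(n,d)$.
   Context: A boolean function $f:\{-1,1\}^n\to\{-1,1\}$ is an $(n,d)$-PTF if there is a polynomial $p\in\mathbb{R}[x_1,\dots,x_n]$ of degree at most $d$ with $f(x)=\mathrm{sgn}(p(x))$ for all $x\in\{-1,1\}^n$. The dichromatic count $\mathbf{D}[f]$ is the number of unordered pairs $\{x,y\}$ of points of $\{-1,1\}^n$ differing in exactly one coordinate with $f(x)\ne f(y)$. Let $p^*_{n,d}$ be the monic univariate polynomial of degree $d$ with (non-repeated) roots at the $d$ integers closest to $0$ of opposite parity from $n$, and let $f^*_{n,d}(x)=\mathrm{sgn}\left(p^*_{n,d}\left(\sum_{i=1}^n x_i\right)\right)$. An $(n,d)$-HSF is an $(n,d)$-PTF $f$ with $\mathbf{D}[f] > \mathbf{D}[f^*_{n,d}]$. *)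

(* Defs.v *)
From HB Require Import structures.
From mathcomp Require Import all_boot all_order all_algebra.
From mathcomp Require Import zify.
From mathcomp Require Import all_classical all_reals all_analysis.
(* the notations of mpoly clash with those of mathcomp-analysis *)
From mathcomp Require Import -(notations) mpoly.

Set Implicit Arguments.
Unset Strict Implicit.
Unset Printing Implicit Defensive.

Import Order.TTheory GRing.Theory Num.Theory.
Local Open Scope ring_scope.

(* A point of {-1,1}^n, encoded by the set of coordinates equal to 1;
   [coord x i] is the actual i-th coordinate. *)
Definition cube (n : nat) := {ffun 'I_n -> bool}.

Definition coord (R : realType) (n : nat) (x : cube n) (i : 'I_n) : R :=
  if x i then 1 else -1.

Definition boolean_function (R : realType) (n : nat) (f : cube n -> R) : Prop :=
  forall x, f x = 1 \/ f x = -1.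

(* [msize p] is the total degree plus one.  Since [Num.sg 0 = 0], a polynomial
   representing a boolean function does not vanish on the cube. *)
Definition PTF (R : realType) (n d : nat) (f : cube n -> R) : Prop :=
  boolean_function f /\
  exists p : mpoly.mpoly n R,
    (mpoly.msize p <= d.+1)%N /\
    forall x, f x = Num.sg (mpoly.meval (coord R x) p).

Definition adjacent (n : nat) (x y : cube n) : bool :=
  #|[set i | x i != y i]%SET| == 1%N.

Definition dichromatic (R : realType) (n : nat) (f : cube n -> R) : nat :=
  #|[set e : {set cube n} |
      [exists x, exists y,
         [&& e == [set x; y]%SET, adjacent x y & f x != f y]]]%SET|.

(* [s] lists the d integers closest to 0 among those of parity opposite to n.
   They are unique when n and d have the same parity; otherwise the last root
   is one of two opposite integers, and both choices are allowed. *)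
Definition closest_roots (n d : nat) (s : seq int) : Prop :=
  [/\ uniq s, size s = d,
      forall a : int, a \in s -> odd `|a|%N != odd n &
      forall a b : int, a \in s -> odd `|b|%N != odd n -> b \notin s ->
        `|a| <= `|b| ].

Definition pstar (R : realType) (s : seq int) : {poly R} :=
  \prod_(a <- s) ('X - (a%:~R)%:P).

Definition fstar (R : realType) (n : nat) (s : seq int) (x : cube n) : R :=
  Num.sg (pstar R s).[\sum_(i < n) coord R x i].

Definition HSF (R : realType) (n d : nat) (f : cube n -> R) : Prop :=
  PTF d f /\
  forall s, closest_roots n d s ->
    (dichromatic (@fstar R n s) < dichromatic f)%N.

(* The integers of parity opposite to n, by increasing absolute value. *)
Definition nth_root (n k : nat) : int :=
  if odd k == odd n then k.+1%:Z else - k%:Z.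

Lemma closest_roots_exist (n d : nat) : exists s, closest_roots n d s.
Proof.
exists [seq nth_root n k | k <- iota 0 d]; split.
- rewrite map_inj_in_uniq ?iota_uniq // => j k _ _; rewrite /nth_root.
  by case: ifP; case: ifP; lia.
- by rewrite size_map size_iota.
- move=> a /mapP[k _ ->]; rewrite /nth_root; case: ifP; lia.
- move=> a b /mapP[j]; rewrite mem_iota => /andP[_ jd] -> bn bs.
  have [k kE] : exists k, b = nth_root n k.
    exists (if (0 < b)%R then `|b|%N.-1 else `|b|%N).
    rewrite /nth_root; case: ifP; case: ifP; lia.
  have dk : (d <= k)%N.
    rewrite leqNgt; apply/negP => kd; move/negP: bs; apply.
    by rewrite kE; apply: map_f; rewrite mem_iota.
  rewrite kE /nth_root; case: ifP; case: ifP; lia.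
Qed.

(* So the value of the sign function at 0 plays no role in [fstar]. *)
Lemma fstar_boolean (R : realType) (n d : nat) (s : seq int) :
  closest_roots n d s -> boolean_function (@fstar R n s).
Proof.
move=> [_ _ par _] x.
have [m [mE mo]] : exists m : int,
    \sum_(i < n) coord R x i = m%:~R /\ odd `|m|%N = odd n.
  exists (\sum_(i < n) (if x i then 1 else -1)); split.
    rewrite rmorph_sum /=; apply: eq_bigr => i _; rewrite /coord.
    by case: (x i); rewrite ?rmorphN ?rmorph1.
  elim: n x {par} => [|n IH] x; first by rewrite big_ord0.
  rewrite big_ord_recr /=.
  have := IH [ffun i => x (widen_ord (leqnSn n) i)].
  rewrite (eq_bigr (fun i => if x (widen_ord (leqnSn n) i) then 1 else -1)).
    by set t := (\sum_(i < n) _); case: (x ord_max) => /=; lia.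
  by move=> i _; rewrite ffunE.
have nz : (pstar R s).[\sum_(i < n) coord R x i] != 0.
  rewrite mE; apply/negP => /eqP/rootP.
  rewrite /pstar -(big_map (fun a : int => a%:~R) xpredT (fun a => 'X - a%:P)).
  rewrite root_prod_XsubC => /mapP[a as_ /intr_inj ma].
  by have := par _ as_; rewrite -ma mo eqxx.
rewrite /fstar; case: sgrP nz => //; by [left | right].
Qed.

(* Main.v *)
Require Import Defs.
From HB Require Import structures.
From mathcomp Require Import all_boot all_order all_algebra.
From mathcomp Require Import zify ring lra.
From mathcomp Require Import all_classical all_reals all_analysis.
From mathcomp Require Import -(notations) mpoly.

Set Implicit Arguments.
Unset Strict Implicit.
Unset Printing Implicit Defensive.

Import Defs.
Import Order.TTheory GRing.Theory Num.Theory.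
Local Open Scope ring_scope.

(* Write [n = m + N] with [m = 2] if [n] and [d] have opposite parities and
   [m = 3] otherwise, so that [N = 2 l + d + 1].  Let [k] be the number of ones
   among the last [N] coordinates and [a] the number of ones among the first
   [m].  Starting from [(k - l - 1) ... (k - l - d)], whose roots sit on the
   layers [l+1 .. l+d] of the [N]-cube, a small perturbation of degree [d] in
   all variables may push each root up or down, differently for each [a].  In
   [f*] the root set of the slice [a] is an interval translated by one step
   for each increment of [a]; in the extreme slices this interval is badly
   centred.  There we use instead a centred set with a gap: one loses the
   cross edges of one outer layer, but gains more inside the slice.  The net
   gain is [(d - 1) 'C(N, l)], resp. [2 (d - 2) 'C(N, l)], and
   ['C(N, l)] is at least [exp(- (d + 1)^2 / N)] times the middle binomial. *)

(** * Counting dichromatic edges *)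

Definition flip (n : nat) (x : cube n) (i : 'I_n) : cube n :=
  [ffun j => if j == i then ~~ x j else x j].

Lemma flip_eq (n : nat) (x : cube n) (i : 'I_n) : flip x i i = ~~ x i.
Proof. by rewrite ffunE eqxx. Qed.

Lemma flip_neq (n : nat) (x : cube n) (i j : 'I_n) :
  j != i -> flip x i j = x j.
Proof. by move=> ji; rewrite ffunE (negPf ji). Qed.

Lemma flipK (n : nat) (i : 'I_n) : involutive (fun x : cube n => flip x i).
Proof.
by move=> x; apply/ffunP => j; rewrite !ffunE; case: eqP => // _; rewrite negbK.
Qed.

Lemma adjacentP (n : nat) (x y : cube n) :
  reflect (exists i, y = flip x i) (adjacent x y).
Proof.
apply: (iffP cards1P) => -[i].
  move=> /setP xy; exists i; apply/ffunP => j; rewrite ffunE.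
  by move: (xy j); rewrite !inE; case: (j == i); case: (x j); case: (y j).
move=> ->; exists i; apply/setP => j; rewrite !inE ffunE.
by case: (j == i); rewrite ?eqxx //; case: (x j).
Qed.

(** Each edge is counted once, from its endpoint where the differing coordinate is -1. Most of the
    proof is the injectivity of this encoding by pairs [(x, i)]. *)
Lemma dichromatic_sum (R : realType) (n : nat) (f : cube n -> R) :
  dichromatic f =
    (\sum_(x : cube n) \sum_(i < n) (~~ x i && (f x != f (flip x i))))%N.
Proof.
pose P := [set xi : cube n * 'I_n |
  ~~ xi.1 xi.2 && (f xi.1 != f (flip xi.1 xi.2))]%SET.
pose edge (xi : cube n * 'I_n) := [set xi.1; flip xi.1 xi.2]%SET.
have -> : dichromatic f = #|edge @: P|.
  rewrite /dichromatic; congr #|pred_of_set _|; apply/setP => e; rewrite inE.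
  apply/existsP/imsetP => [[x /existsP[y /and3P[/eqP eE /adjacentP[i yE] fxy]]]|].
    case xi: (x i); last first.
      by exists (x, i); rewrite ?inE ?eE /edge /= ?xi -?yE.
    exists (y, i); rewrite ?inE /= {1}yE ?flip_eq ?xi /=.
      by rewrite yE flipK -yE eq_sym.
    by rewrite eE /edge /= yE flipK finset.setUC.
  move=> [[x i]]; rewrite inE /= => /andP[xi fxi] ->.
  exists x; apply/existsP; exists (flip x i); rewrite eqxx fxi andbT /=.
  by apply/adjacentP; exists i.
rewrite card_in_imset.
  rewrite pair_bigA -sum1dep_card big_mkcond /=; apply: eq_bigr => xi _.
  by case: ifP.
move=> [x i] [y j]; rewrite !inE /= => /andP[xi _] /andP[yj _] /setP exy.
have fixi : flip x i != x.
  by apply/eqP => /ffunP/(_ i); rewrite flip_eq; case: (x i).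
have /orP[/eqP yx|/eqP yx] : (y == x) || (y == flip x i).
  by have := exy y; rewrite !inE eqxx.
  have /orP[/eqP h|/eqP h] : (flip x i == y) || (flip x i == flip y j).
    by have := exy (flip x i); rewrite !inE eqxx orbT.
    by rewrite h yx eqxx in fixi.
  congr (_, _) => //; apply/eqP; apply: contraT => nij.
  move/ffunP/(_ i): h; rewrite yx flip_eq flip_neq //.
  by case: (x i).
(* The crosswise matching [y = flip x i], [x = flip y j] would force [i = j], and then [y] has a 1
   at its marked coordinate. *)
have /orP[/eqP h|/eqP h] : (x == y) || (x == flip y j).
  by have := exy x; rewrite !inE eqxx.
  by rewrite {2}h yx eqxx in fixi.
have [ij|nij] := eqVneq i j.
  by rewrite yx -ij flip_eq xi in yj.
by move/ffunP/(_ i): h; rewrite flip_neq // yx flip_eq; case: (x i).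
Qed.

(** These are the counts a and k of the overview; the functions constructed below depend on them
    alone. *)
Definition ones_lo (m n : nat) (x : cube n) : nat := \sum_(i < n | (i < m)%N) x i.
Definition ones_hi (m n : nat) (x : cube n) : nat := \sum_(i < n | ~~ (i < m)%N) x i.

Lemma sum_flip (n : nat) (P : pred 'I_n) (x : cube n) (i : 'I_n) : ~~ x i ->
  (\sum_(j < n | P j) flip x i j = \sum_(j < n | P j) x j + P i)%N.
Proof.
move=> xi; case: (boolP (P i)) => Pi.
  rewrite (bigD1 i) //= [in RHS](bigD1 i) //= flip_eq (negPf xi) add0n addnC.
  congr addn; apply: eq_bigr => j /andP[_ ji]; by rewrite flip_neq.
rewrite addn0; apply: eq_bigr => j Pj; rewrite flip_neq //.
by apply: contraTneq Pj => ->.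
Qed.

Lemma sum_zeros (n : nat) (P : pred 'I_n) (x : cube n) :
  (\sum_(i < n | P i) ~~ x i = #|P| - \sum_(i < n | P i) x i)%N.
Proof.
suff -> : #|P| = (\sum_(i < n | P i) ~~ x i + \sum_(i < n | P i) x i)%N.
  by rewrite addnK.
rewrite -big_split -sum1_card /=; apply: eq_bigr => i _; by case: (x i).
Qed.

Lemma card_lo (m N : nat) : #|[pred i : 'I_(m + N) | (i < m)%N]| = m.
Proof.
rewrite -sum1_card big_split_ord /= [X in (_ + X)%N]big_pred0 ?addn0.
  rewrite (eq_bigl xpredT) ?sum1_card ?card_ord // => i /=.
  by rewrite inE /= ltn_ord.
by move=> i; rewrite inE /= ltnNge leq_addr.
Qed.

Lemma card_hi (m N : nat) : #|[pred i : 'I_(m + N) | ~~ (i < m)%N]| = N.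
Proof.
rewrite -sum1_card big_split_ord /= big_pred0 ?add0n.
  rewrite (eq_bigl xpredT) ?sum1_card ?card_ord // => i /=.
  by rewrite inE /= ltnNge leq_addr.
by move=> i; rewrite inE /= ltn_ord.
Qed.

Definition cube_cons (n : nat) (b : bool) (x : cube n) : cube n.+1 :=
  [ffun i => if unlift ord0 i is Some j then x j else b].

Lemma cube_cons0 (n : nat) b (x : cube n) : cube_cons b x ord0 = b.
Proof. by rewrite ffunE unlift_none. Qed.

Lemma cube_consS (n : nat) b (x : cube n) i : cube_cons b x (lift ord0 i) = x i.
Proof. by rewrite ffunE liftK. Qed.

Lemma sum_cubeS (n : nat) (H : cube n.+1 -> nat) :
  (\sum_x H x = \sum_(x : cube n) (H (cube_cons true x) + H (cube_cons false x)))%N.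
Proof.
rewrite big_split /=.
rewrite -(big_bool addn (fun b => \sum_x H (cube_cons b x))%N).
rewrite pair_bigA /= (reindex (fun bx : bool * cube n => cube_cons bx.1 bx.2)) //.
exists (fun y : cube n.+1 => (y ord0, [ffun i => y (lift ord0 i)])).
  move=> [b x] _ /=; rewrite cube_cons0; congr (_, _).
  by apply/ffunP => i; rewrite ffunE cube_consS.
move=> y _ /=; apply/ffunP => i; rewrite ffunE.
by case: unliftP => [j ->|->] //; rewrite ffunE.
Qed.

(** Pascal's rule in summed form, parallel to the splitting of the cube along its first coordinate
    in [sum_cubeS]. *)
Lemma sum_binS (N : nat) (F : nat -> nat) :
  (\sum_(b < N.+2) 'C(N.+1, b) * F b =
   \sum_(b < N.+1) 'C(N, b) * (F b.+1 + F b))%N.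
Proof.
rewrite big_ord_recl /= bin0 mul1n.
under eq_bigr => i _ do rewrite /bump /= add1n binS mulnDl.
rewrite big_split /= big_ord_recr /= bin_small // mul0n addn0.
under [in RHS]eq_bigr => i _ do rewrite mulnDr.
rewrite big_split /= addnA addnC; congr addn.
by rewrite [in RHS]big_ord_recl bin0 mul1n.
Qed.

Lemma sum_cube_symmetric (N : nat) (F : nat -> nat) :
  (\sum_(x : cube N) F (\sum_(i < N) x i) = \sum_(b < N.+1) 'C(N, b) * F b)%N.
Proof.
elim: N F => [|N IH] F.
  rewrite big_ord1 bin0 mul1n (big_pred1 [ffun=> false]) ?big_ord0 // => x.
  by apply/esym/eqP/ffunP; case.
rewrite sum_binS sum_cubeS -(IH (fun b => F b.+1 + F b)%N).
apply: eq_bigr => x _; rewrite !big_ord_recl !cube_cons0 add1n add0n.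
by congr (F _.+1 + F _)%N; apply: eq_bigr => i _; rewrite cube_consS.
Qed.

(** Induction on [m], removing the first block one coordinate at a time; once it is empty, only the
    total number of ones is left. *)
Lemma sum_cube_bin (m N : nat) (F : nat -> nat -> nat) :
  (\sum_(x : cube (m + N)) F (ones_lo m x) (ones_hi m x) =
   \sum_(a < m.+1) 'C(m, a) * \sum_(b < N.+1) 'C(N, b) * F a b)%N.
Proof.
elim: m F => [|m IH] F.
  rewrite big_ord1 bin0 mul1n -sum_cube_symmetric.
  by apply: eq_bigr => x _; rewrite /ones_lo big_pred0.
rewrite (sum_binS m (fun a => \sum_(b < N.+1) 'C(N, b) * F a b)%N) sum_cubeS.
under [in RHS]eq_bigr => a _.
  rewrite -big_split /=; under eq_bigr => b _ do rewrite -mulnDr; over.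
rewrite -(IH (fun a b => F a.+1 b + F a b)%N).
apply: eq_bigr => x _; rewrite /ones_lo /ones_hi.
have loE b : (\sum_(i < (m + N).+1 | (i < m.+1)%N) cube_cons b x i =
    b + \sum_(i < m + N | (i < m)%N) x i)%N.
  rewrite big_mkcond big_ord_recl /= cube_cons0 [in RHS]big_mkcond.
  by congr addn; apply: eq_bigr => i _; rewrite cube_consS.
have hiE b : (\sum_(i < (m + N).+1 | ~~ (i < m.+1)%N) cube_cons b x i =
    \sum_(i < m + N | ~~ (i < m)%N) x i)%N.
  rewrite big_mkcond big_ord_recl /= add0n [in RHS]big_mkcond.
  by apply: eq_bigr => i _; rewrite cube_consS.
by rewrite !loE !hiE add1n add0n.
Qed.

(** From a point with counts [(a, b)], [m - a] upward edges lead to [(a + 1, b)] and [N - b] to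
    [(a, b + 1)]. The factors vanish at [a = m] and [b = N], where [G] would be evaluated out of
    range. *)
Lemma dichromatic_bisymmetric (R : realType) (m N : nat)
    (f : cube (m + N) -> R) (G : nat -> nat -> R) :
  (forall x, f x = G (ones_lo m x) (ones_hi m x)) ->
  dichromatic f =
    (\sum_(a < m.+1) 'C(m, a) * \sum_(b < N.+1) 'C(N, b) *
       ((m - a) * (G a b != G a.+1 b) + (N - b) * (G a b != G a b.+1)))%N.
Proof.
move=> fG.
rewrite dichromatic_sum -(sum_cube_bin _ _ (fun a b =>
  (m - a) * (G a b != G a.+1 b) + (N - b) * (G a b != G a b.+1))%N).
apply: eq_bigr => x _; rewrite (bigID (fun i : 'I__ => (i < m)%N)) /=.
have lo := sum_zeros [pred i : 'I_(m + N) | (i < m)%N] x.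
have hi := sum_zeros [pred i : 'I_(m + N) | ~~ (i < m)%N] x.
rewrite card_lo in lo; rewrite card_hi in hi; rewrite /ones_lo /ones_hi.
rewrite -lo -hi !big_distrl /=; congr addn; apply: eq_bigr => i im.
  case xi: (x i) => //=; rewrite mul1n !fG /ones_lo /ones_hi !sum_flip ?xi //.
  by rewrite im addn1 addn0.
case xi: (x i) => //=; rewrite mul1n !fG /ones_lo /ones_hi !sum_flip ?xi //.
by rewrite (negPf im) addn1 addn0.
Qed.

(** * Centred windows of binomials and the upper bound for f* *)

Lemma sum_window (h : nat -> nat) (n a d : nat) : (a + d <= n)%N ->
  (\sum_(K < n) h K * (a <= K < a + d) = \sum_(i < d) h (a + i))%N.
Proof.
move=> adn; rewrite -(subnKC adn) big_split_ord big_split_ord /=.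
rewrite big1 ?add0n; last by move=> i _; rewrite leqNgt ltn_ord muln0.
rewrite [X in (_ + X)%N]big1 ?addn0; last first.
  by move=> i _; rewrite [(_ + i < _)%N]ltnNge leq_addr andbF muln0.
by apply: eq_bigr => i _; rewrite leq_addr ltn_add2l ltn_ord muln1.
Qed.

(** The hypotheses say that [j] is at least as close to [M / 2] as [i]. A [j] beyond the middle is
    replaced by its mirror [M - j]. *)
Lemma leq_bin_center (M i j : nat) : (i <= j)%N -> (i + j <= M)%N ->
  ('C(M, i) <= 'C(M, j))%N.
Proof.
move=> ij ijM.
have step k : (k.*2 < M)%N -> ('C(M, k) <= 'C(M, k.+1))%N.
  move=> kM; rewrite -(leq_pmul2l (ltn0Sn k)) mul_bin_left leq_mul2r; lia.
have half k : (i <= k)%N -> (k.*2 <= M)%N -> ('C(M, i) <= 'C(M, k))%N.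
  elim: k => [|k IH]; first by rewrite leqn0 => /eqP ->.
  rewrite leq_eqVlt => /orP[/eqP -> //|ik] kM.
  by apply: leq_trans (IH _ _) (step _ _); lia.
have [jM|Mj] := leqP j.*2 M; first exact: half.
by rewrite -(@bin_sub M j); [apply: half; lia | lia].
Qed.

(** Exchange argument: the common part cancels, and what is left of [A] and of [W] is compared
    through the threshold [mu]. *)
Lemma sum_le_top (T : finType) (A W : {set T}) (h : T -> nat) (mu : nat) :
  (#|A| <= #|W|)%N ->
  (forall x, x \notin W -> (h x <= mu)%N) ->
  (forall x, x \in W -> (mu <= h x)%N) ->
  (\sum_(x in A) h x <= \sum_(x in W) h x)%N.
Proof.
move=> AW hmu muh; rewrite (big_setID W) [leqRHS](big_setID A) finset.setIC.
rewrite leq_add2l; apply: (@leq_trans (#|A :\: W|%SET * mu)).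
  rewrite -sum_nat_const; apply: leq_sum => x; rewrite inE => /andP[xW _].
  exact: hmu.
apply: (@leq_trans (#|W :\: A|%SET * mu)).
  rewrite leq_mul2r; apply/orP; right; rewrite -(leq_add2l #|A :&: W|%SET).
  by rewrite cardsID finset.setIC cardsID.
rewrite -sum_nat_const; apply: leq_sum => x; rewrite inE => /andP[_ xW].
exact: muh.
Qed.

Lemma sum_coord (R : realType) (n : nat) (x : cube n) :
  \sum_(i < n) coord R x i = ((\sum_(i < n) x i)%N%:R *+ 2) - n%:R.
Proof.
rewrite natr_sum -sumrMnl -[X in _ - X%:R]card_ord -sumr_const.
rewrite big_mkcond /= -sumrB; apply: eq_bigr => i _.
by rewrite /coord; case: (x i) => /=; lra.
Qed.

(** The bisymmetric count with an empty first block; the factor [n] comes from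
    [(n - K) 'C(n, K) = n 'C(n.-1, K)]. *)
Lemma dichromatic_symmetric (R : realType) (n : nat) (f : cube n -> R)
    (g : nat -> R) : (forall x, f x = g (\sum_(i < n) x i)%N) ->
  dichromatic f = (n * \sum_(K < n) 'C(n.-1, K) * (g K != g K.+1))%N.
Proof.
move=> fg; rewrite (@dichromatic_bisymmetric R 0 n f (fun _ => g)); last first.
  by move=> x; rewrite fg.
rewrite big_ord1 mul1n big_ord_recr /= !subnn !mul0n muln0 addn0.
rewrite big_distrr /=; apply: eq_bigr => K _.
by rewrite mul0n add0n !mulnA mul_bin_down; congr muln; rewrite mulnC.
Qed.

(** The only integer of parity opposite to [n] between [2K - n] and [2K + 2 - n] is [2K + 1 - n]. If
    it is not a root, every factor keeps its sign. *)
Lemma pstar_sg (R : realType) (n K : nat) (s : seq int) :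
  (forall a : int, a \in s -> odd `|a|%N != odd n) ->
  K.+1%:Z + K%:Z - n%:Z \notin s ->
  Num.sg (pstar R s).[K%:R *+ 2 - n%:R] =
  Num.sg (pstar R s).[K.+1%:R *+ 2 - n%:R].
Proof.
move=> par Ks; rewrite /pstar !horner_prod.
rewrite !(big_morph _ (@sgrM R) (@sgr1 R)); apply: eq_big_seq => a sa.
rewrite !hornerXsubC.
have -> : K%:R *+ 2 - n%:R - a%:~R = (K%:Z *+ 2 - n%:Z - a)%:~R :> R.
  by rewrite !rmorphB rmorphMn.
have -> : K.+1%:R *+ 2 - n%:R - a%:~R = (K.+1%:Z *+ 2 - n%:Z - a)%:~R :> R.
  by rewrite !rmorphB rmorphMn.
have aK : a != K.+1%:Z + K%:Z - n%:Z by apply: contraNneq Ks => <-.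
have pa := par _ sa.
have [lt0|gt0] : (K.+1%:Z *+ 2 - n%:Z - a < 0) \/ (0 < K%:Z *+ 2 - n%:Z - a).
  lia.
  by rewrite !ltr0_sg ?ltrz0 //; lia.
by rewrite !gtr0_sg ?ltr0z //; lia.
Qed.

(** The sign changes occupy at most [d] levels, and [d] binomials of row [M] sum to at most a
    centred window of them. The condition on [a] centres the window exactly if [2a + d = M + 1], and
    up to half a step if [2a + d = M]. *)
Lemma dichromatic_fstar_le (R : realType) (M d a : nat) (s : seq int) :
  closest_roots M.+1 d s -> (0 < d)%N -> (M <= a.*2 + d <= M.+1)%N ->
  (dichromatic (@fstar R M.+1 s) <= M.+1 * \sum_(i < d) 'C(M, a + i))%N.
Proof.
move=> [us ss par _] d0 /andP[ad1 ad2].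
rewrite (@dichromatic_symmetric R _ _
  (fun K => Num.sg (pstar R s).[K%:R *+ 2 - M.+1%:R])); last first.
  by move=> x; rewrite /fstar sum_coord.
rewrite leq_mul2l /=.
(* The integer between the coordinate sums of layers [K] and [K + 1]. *)
pose root_of (K : 'I_M.+1) : int := (K : nat).+1%:Z + (K : nat)%:Z - M.+1%:Z.
pose A := [set K : 'I_M.+1 | root_of K \in s]%SET.
pose W := [set K : 'I_M.+1 | (a <= K < a + d)%N]%SET.
have root_inj : injective root_of.
  by move=> i j; rewrite /root_of => ij; apply/val_inj => /=; lia.
apply: (@leq_trans (\sum_(K in A) 'C(M, K))%N).
  rewrite [leqRHS]big_mkcond; apply: leq_sum => K _; rewrite inE.
  case: ifPn => [_|Ks]; first by case: eqP => _ /=; lia.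
  by rewrite (pstar_sg R par Ks) eqxx muln0.
rewrite -(@sum_window (fun K => 'C(M, K)) M.+1); last by lia.
have WE (h : nat -> nat) :
    (\sum_(K < M.+1) h K * (a <= K < a + d) = \sum_(K in W) h K)%N.
  rewrite [RHS]big_mkcond; apply: eq_bigr => K _; rewrite inE.
  by case: (_ && _); rewrite ?muln1 ?muln0.
(* The left end of the window carries its smallest binomial, which serves as the threshold. *)
rewrite WE; apply: (@sum_le_top _ _ _ _ 'C(M, a)).
- have -> : #|W| = d.
    rewrite -sum1_card -(WE (fun=> 1%N)) (@sum_window (fun=> 1%N)); last by lia.
    by rewrite sum1_card card_ord.
  rewrite -ss cardE -(size_map root_of); apply: uniq_leq_size.
    by rewrite map_inj_uniq ?enum_uniq.
  by move=> r /mapP[K]; rewrite mem_enum inE => KA ->.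
- move=> K; rewrite inE => KW; have := ltn_ord K => Klt.
  have [Ka|aK] := ltnP K a; first by apply: leq_bin_center; lia.
  by rewrite -(@bin_sub M K); [apply: leq_bin_center; lia | lia].
- by move=> K; rewrite inE => KW; apply: leq_bin_center; lia.
Qed.

(** * Sign patterns of the slices *)

Definition window_sum (h : nat -> nat) (a d : nat) : nat := \sum_(i < d) h (a + i)%N.

Lemma window_sumS (h : nat -> nat) (a d : nat) :
  (window_sum h a d.+1 = h a + window_sum h a.+1 d)%N.
Proof.
rewrite /window_sum big_ord_recl addn0; congr addn.
by apply: eq_bigr => i _; rewrite addSnnS.
Qed.

Lemma window_sumSr (h : nat -> nat) (a d : nat) :
  (window_sum h a d.+1 = window_sum h a d + h (a + d))%N.
Proof. by rewrite /window_sum big_ord_recr. Qed.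

(** The number of edges of the [N]-cube between layers [k] and [k + 1], called edge level [k]
    below. *)
Definition up_edges (N k : nat) : nat := 'C(N, k) * (N - k).

(** The contribution of one slice: [u] marks sign changes inside it, [v] disagreements with the next
    slice, and [c] counts the coordinates of the first block that can still be raised. Two windows
    for [u] allow for a gap. *)
Lemma sum_windows (N : nat) (c : nat) (u v : nat -> bool) (a b p q r s : nat) :
  (forall k, (u k : nat) = (a <= k < a + b)%N + (p <= k < p + q)%N)%N ->
  (forall k, (v k : nat) = (r <= k < r + s)%N) ->
  (a + b <= N.+1)%N -> (p + q <= N.+1)%N -> (r + s <= N.+1)%N ->
  (\sum_(k < N.+1) 'C(N, k) * (c * v k + (N - k) * u k) =
   c * window_sum (binomial N) r s +
   (window_sum (up_edges N) a b + window_sum (up_edges N) p q))%N.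
Proof.
move=> uE vE ab pq rs; rewrite /window_sum -!(@sum_window _ N.+1) //.
rewrite big_distrr -!big_split /=; apply: eq_bigr => k _.
rewrite /up_edges uE vE; lia.
Qed.

(* Sign patterns along one slice of the cube, as parities of the number of
   roots above layer [k].  The roots sit just below the layers l+1..l+d,
   just above them, just above them except below l+1, and just below them
   except above l+d. *)
Definition neg_below (l d k : nat) : bool := odd (minn d (l + d - k)).
Definition neg_above (l d k : nat) : bool := odd (minn d ((l + d).+1 - k)).
Definition neg_above_but_first (l d k : nat) : bool :=
  odd (if (k <= l)%N then d else if k == l.+1 then d.-1 else (l + d).+1 - k)%N.
Definition neg_below_but_last (l d k : nat) : bool :=
  odd (if (k < l + d)%N then minn d (l + d - k) else (k == l + d)%N : nat).

(** In f* slice [a] changes sign on the [d] edge levels starting at [l + 1 - a]. This is kept for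
    [a = 0, 1]; slice 2 gets the gapped pattern. *)
Definition neg2 (l d a k : nat) : bool :=
  match a with
  | 0 => neg_above l d k
  | 1 => neg_below l d k
  | _ => neg_above_but_first l d k
  end.

(** Here the intervals of f* start at [l + 2 - a]. The two middle slices keep them; the extreme ones
    get gapped patterns that mirror each other. *)
Definition neg3 (l d a k : nat) : bool :=
  match a with
  | 0 => neg_below_but_last l d k
  | 1 => neg_above l d k
  | 2 => neg_below l d k
  | _ => neg_above_but_first l d k
  end.

Lemma neg_belowS (l d k : nat) : neg_below l d k != neg_below l d k.+1 = (l <= k < l + d)%N.
Proof. by rewrite /neg_below; lia. Qed.

Lemma neg_aboveS (l d k : nat) :
  neg_above l d k != neg_above l d k.+1 = (l.+1 <= k < l.+1 + d)%N.
Proof. by rewrite /neg_above; lia. Qed.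

Lemma neg_above_but_firstS (l d k : nat) : (3 <= d)%N ->
  (neg_above_but_first l d k != neg_above_but_first l d k.+1 : nat) =
  ((l <= k < l + 1)%N + (l.+2 <= k < l.+2 + d.-1)%N)%N.
Proof. by move=> d3; rewrite /neg_above_but_first; do ?case: ifP; lia. Qed.

Lemma neg_below_but_lastS (l d k : nat) : (3 <= d)%N ->
  (neg_below_but_last l d k != neg_below_but_last l d k.+1 : nat) =
  ((l <= k < l + d.-1)%N + (l + d <= k < l + d + 1)%N)%N.
Proof. by move=> d3; rewrite /neg_below_but_last; do ?case: ifP; lia. Qed.

Lemma neg_above_below (l d k : nat) :
  neg_above l d k != neg_below l d k = (l.+1 <= k < l.+1 + d)%N.
Proof. by rewrite /neg_above /neg_below; lia. Qed.

Lemma neg_below_above_but_first (l d k : nat) : (3 <= d)%N ->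
  neg_below l d k != neg_above_but_first l d k = (l.+2 <= k < l.+2 + d.-1)%N.
Proof. by move=> d3; rewrite /neg_below /neg_above_but_first; do ?case: ifP; lia. Qed.

Lemma neg_below_but_last_above (l d k : nat) : (3 <= d)%N ->
  neg_below_but_last l d k != neg_above l d k = (l.+1 <= k < l.+1 + d.-1)%N.
Proof. by move=> d3; rewrite /neg_below_but_last /neg_above; do ?case: ifP; lia. Qed.

(** * Dichromatic counts of the two constructions *)

Lemma up_edgesE (N k : nat) : up_edges N k = (k.+1 * 'C(N, k.+1))%N.
Proof. by rewrite mul_bin_left mulnC. Qed.

Lemma bin_mirror (l d i j : nat) : (i + j)%N = d.+1 ->
  'C(l.*2 + d.+1, l + i) = 'C(l.*2 + d.+1, l + j).
Proof.
move=> ij; rewrite -(@bin_sub _ (l + j)); last by lia.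
by congr binomial; lia.
Qed.

Lemma up_edges_mirror (l d i j : nat) : (i + j)%N = d ->
  up_edges (l.*2 + d.+1) (l + i) = up_edges (l.*2 + d.+1) (l + j).
Proof.
move=> ij; rewrite up_edgesE -addnS (@bin_mirror l d i.+1 j); last by lia.
by rewrite /up_edges mulnC; congr muln; lia.
Qed.

Lemma sign_neq (R : realType) (a b : bool) :
  ((-1) ^+ a != (-1) ^+ b :> R) = (a != b).
Proof. by rewrite (inj_eq (@signr_inj R)). Qed.

(** Both sides count the edges of the [(N + 2)]-cube between layers [k + 1] and [k + 2]: on the
    right, first those inside slices 0, 1, 2, then the cross edges from slice 0 to 1 and from 1 to
    2. *)
Lemma edge_layer2 (N k : nat) : (k < N)%N ->
  (N.+2 * 'C(N.+1, k.+1) =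
   up_edges N k.+1 + 2 * up_edges N k + k * 'C(N, k) +
   2 * 'C(N, k.+1) + 2 * 'C(N, k))%N.
Proof.
move=> kN; have := mul_bin_left N k; rewrite /up_edges binS.
set x := 'C(N, k); set y := 'C(N, k.+1).
have [q ->] : exists q, N = (k + q).+1 by exists (N - k.+1)%N; lia.
have -> : ((k + q).+1 - k = q.+1)%N by lia.
have -> : ((k + q).+1 - k.+1 = q)%N by lia.
nia.
Qed.

(** The same count in the [(N + 3)]-cube between layers [k + 2] and [k + 3], with slices of
    multiplicities 1, 3, 3, 1. *)
Lemma edge_layer3 (N k : nat) : (k.+1 < N)%N ->
  (N.+3 * 'C(N.+2, k.+2) =
   up_edges N k.+2 + 3 * up_edges N k.+1 + 3 * up_edges N k + k * 'C(N, k) +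
   3 * ('C(N, k.+2) + 2 * 'C(N, k.+1) + 'C(N, k)))%N.
Proof.
move=> kN; have := mul_bin_left N k; have := mul_bin_left N k.+1.
rewrite /up_edges !binS.
set x := 'C(N, k); set y := 'C(N, k.+1); set z := 'C(N, k.+2).
have [q ->] : exists q, N = (k + q).+2 by exists (N - k.+2)%N; lia.
have -> : ((k + q).+2 - k = q.+2)%N by lia.
have -> : ((k + q).+2 - k.+1 = q.+1)%N by lia.
have -> : ((k + q).+2 - k.+2 = q)%N by lia.
nia.
Qed.

(** As [k * 'C(N, k)] counts the edges just below layer [k], the first window is the one of
    [up_edges] moved down by one level. *)
Lemma window_sum_down (N l d : nat) :
  (window_sum (fun k => k * 'C(N, k)) l d + (l + d) * 'C(N, l + d) =
   l * 'C(N, l) + window_sum (up_edges N) l d)%N.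
Proof.
rewrite -(window_sumSr (fun k => k * 'C(N, k))%N) window_sumS; congr addn.
by apply: eq_bigr => i _; rewrite up_edgesE addSn.
Qed.

(** The first summand is the count for f*. Up to mirroring, slice 2 exchanges edge level [l - 1] for
    level [l], a gain of [(d + 1) 'C(N, l)], while [2 'C(N, l)] cross edges to slice 1 are lost. *)
Lemma dichromatic_neg2 (R : realType) (l d : nat) (f : cube (2 + (l.*2 + d.+1)) -> R) :
  (3 <= d)%N ->
  (forall x, f x = (-1) ^+ neg2 l d (ones_lo 2 x) (ones_hi 2 x)) ->
  (dichromatic f =
   (l.*2 + d.+1).+2 * \sum_(i < d) 'C((l.*2 + d.+1).+1, l.+1 + i) +
   d.-1 * 'C(l.*2 + d.+1, l))%N.
Proof.
move=> d3 fE; set N := (l.*2 + d.+1)%N.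
rewrite (@dichromatic_bisymmetric R 2 N f (fun a k => (-1) ^+ neg2 l d a k)) //.
have dE : d = d.-1.+1 by lia.
have sum3 (F : nat -> nat) : (\sum_(a < 3) F a = F 0 + (F 1 + F 2))%N.
  by rewrite !big_ord_recl big_ord0 addn0.
pose G a k : R := (-1) ^+ neg2 l d a k.
rewrite (sum3 (fun a => 'C(2, a) * \sum_(b < N.+1) 'C(N, b) *
  ((2 - a) * (G a b != G a.+1 b) + (N - b) * (G a b != G a b.+1)))%N) /G /=.
rewrite bin0 binn bin1 subn0 subnn (_ : 2 - 1 = 1)%N //.
under eq_bigr => k _ do rewrite !sign_neq.
under [X in (_ + (_ * X + _))%N]eq_bigr => k _ do rewrite !sign_neq.
under [X in (_ + (_ + _ * X))%N]eq_bigr => k _ do rewrite !sign_neq.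
rewrite (@sum_windows N 2 (fun k => neg_above l d k != neg_above l d k.+1)
  (fun k => neg_above l d k != neg_below l d k) 0 0 l.+1 d l.+1 d); first 1 last.
- by move=> k; rewrite neg_aboveS; lia.
- by move=> k; rewrite neg_above_below.
- by [].
- by rewrite /N; lia.
- by rewrite /N; lia.
rewrite (@sum_windows N 1 (fun k => neg_below l d k != neg_below l d k.+1)
  (fun k => neg_below l d k != neg_above_but_first l d k) 0 0 l d l.+2 d.-1); first 1 last.
- by move=> k; rewrite neg_belowS; lia.
- by move=> k; rewrite neg_below_above_but_first.
- by [].
- by rewrite /N; lia.
- by rewrite /N; lia.
rewrite (@sum_windows N 0 (fun k => neg_above_but_first l d k != neg_above_but_first l d k.+1)
  (fun k => neg_above_but_first l d k != neg_above_but_first l d k) l 1 l.+2 d.-1 0 0); first 1 last.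
- by move=> k; rewrite neg_above_but_firstS.
- by move=> k; rewrite eqxx ltn0 andbF.
- by rewrite /N; lia.
- by rewrite /N; lia.
- by [].
(* The count for f* is decomposed slice by slice, to be compared window by window. *)
have -> : (N.+2 * \sum_(i < d) 'C(N.+1, l.+1 + i) =
    window_sum (up_edges N) l.+1 d + 2 * window_sum (up_edges N) l d +
    window_sum (fun k => k * 'C(N, k)) l d +
    2 * window_sum (binomial N) l.+1 d + 2 * window_sum (binomial N) l d)%N.
  rewrite /window_sum !big_distrr -!big_split /=; apply: eq_bigr => i _.
  by rewrite addSn edge_layer2 //; have := ltn_ord i; rewrite /N; lia.
have := window_sum_down N l d.
have := window_sumS (up_edges N) l d; have := window_sumSr (up_edges N) l d.
have := window_sumS (binomial N) l d; have := window_sumSr (binomial N) l d.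
have := window_sumS (up_edges N) l.+1 d.-1; have := window_sumS (binomial N) l.+1 d.-1.
(* Complementation identifies edge levels [l + d] and [l], levels [l + d - 1] and [l + 1], and the
   sizes of layers [l + d] and [l + 1]. *)
have := @up_edges_mirror l d d 0 (addn0 d).
have := @up_edges_mirror l d d.-1 1; have := @bin_mirror l d d 1 (addn1 d).
rewrite !addn0 !addn1 -dE -/N => cd /(_ erefl) ed1 ed.
have := up_edgesE N (l + d.-1); rewrite -addnS -dE => ed'.
have e0 : up_edges N l = ('C(N, l) * (l + d.+1))%N.
  by rewrite /up_edges /N; congr muln; lia.
have w1 h a : window_sum h a 1 = h a by rewrite /window_sum big_ord1 addn0.
have w0 h a : window_sum h a 0 = 0%N by rewrite /window_sum big_ord0.
rewrite !w0 w1.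
(* Level [l] pays for the lost level [l - 1], which has [l * 'C(N, l)] edges, and for the lost cross
   edges; the net gain remains. *)
have : (d.-1 * 'C(N, l) + l * 'C(N, l) + 2 * 'C(N, l) = up_edges N l)%N.
  by rewrite e0 -!mulnDl mulnC; congr muln; lia.
move: ed ed' ed1 cd; set e0' := up_edges N l; lia.
Qed.

(** Each extreme slice gains [(d + 1) 'C(N, l)] inside and loses [3 'C(N, l)] cross edges, three
    being the number of edges from an extreme point of the 3-cube. *)
Lemma dichromatic_neg3 (R : realType) (l d : nat) (f : cube (3 + (l.*2 + d.+1)) -> R) :
  (3 <= d)%N ->
  (forall x, f x = (-1) ^+ neg3 l d (ones_lo 3 x) (ones_hi 3 x)) ->
  (dichromatic f =
   (l.*2 + d.+1).+3 * \sum_(i < d) 'C((l.*2 + d.+1).+2, l.+2 + i) +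
   2 * d.-2 * 'C(l.*2 + d.+1, l))%N.
Proof.
move=> d3 fE; set N := (l.*2 + d.+1)%N.
rewrite (@dichromatic_bisymmetric R 3 N f (fun a k => (-1) ^+ neg3 l d a k)) //.
have dE : d = d.-1.+1 by lia.
have sum4 (F : nat -> nat) : (\sum_(a < 4) F a = F 0 + (F 1 + (F 2 + F 3)))%N.
  by rewrite !big_ord_recl big_ord0 addn0.
pose G a k : R := (-1) ^+ neg3 l d a k.
rewrite (sum4 (fun a => 'C(3, a) * \sum_(b < N.+1) 'C(N, b) *
  ((3 - a) * (G a b != G a.+1 b) + (N - b) * (G a b != G a b.+1)))%N) /G /=.
rewrite bin0 binn bin1 subn0 subnn (_ : 3 - 1 = 2)%N // (_ : 3 - 2 = 1)%N //.
rewrite (_ : 'C(3, 2) = 3)%N //.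
under eq_bigr => k _ do rewrite !sign_neq.
under [X in (_ + (_ * X + _))%N]eq_bigr => k _ do rewrite !sign_neq.
under [X in (_ + (_ + (_ * X + _)))%N]eq_bigr => k _ do rewrite !sign_neq.
under [X in (_ + (_ + (_ + _ * X)))%N]eq_bigr => k _ do rewrite !sign_neq.
rewrite (@sum_windows N 3
  (fun k => neg_below_but_last l d k != neg_below_but_last l d k.+1)
  (fun k => neg_below_but_last l d k != neg_above l d k)
  l d.-1 (l + d) 1 l.+1 d.-1); first 1 last.
- by move=> k; rewrite neg_below_but_lastS.
- by move=> k; rewrite neg_below_but_last_above.
- by rewrite /N; lia.
- by rewrite /N; lia.
- by rewrite /N; lia.
rewrite (@sum_windows N 2 (fun k => neg_above l d k != neg_above l d k.+1)
  (fun k => neg_above l d k != neg_below l d k) 0 0 l.+1 d l.+1 d); first 1 last.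
- by move=> k; rewrite neg_aboveS; lia.
- by move=> k; rewrite neg_above_below.
- by [].
- by rewrite /N; lia.
- by rewrite /N; lia.
rewrite (@sum_windows N 1 (fun k => neg_below l d k != neg_below l d k.+1)
  (fun k => neg_below l d k != neg_above_but_first l d k)
  0 0 l d l.+2 d.-1); first 1 last.
- by move=> k; rewrite neg_belowS; lia.
- by move=> k; rewrite neg_below_above_but_first.
- by [].
- by rewrite /N; lia.
- by rewrite /N; lia.
rewrite (@sum_windows N 0
  (fun k => neg_above_but_first l d k != neg_above_but_first l d k.+1)
  (fun k => neg_above_but_first l d k != neg_above_but_first l d k)
  l 1 l.+2 d.-1 0 0); first 1 last.
- by move=> k; rewrite neg_above_but_firstS.
- by move=> k; rewrite eqxx ltn0 andbF.
- by rewrite /N; lia.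
- by rewrite /N; lia.
- by [].
have -> : (N.+3 * \sum_(i < d) 'C(N.+2, l.+2 + i) =
    window_sum (up_edges N) l.+2 d + 3 * window_sum (up_edges N) l.+1 d +
    3 * window_sum (up_edges N) l d + window_sum (fun k => k * 'C(N, k)) l d +
    3 * (window_sum (binomial N) l.+2 d + 2 * window_sum (binomial N) l.+1 d +
         window_sum (binomial N) l d))%N.
  rewrite /window_sum !big_distrr -!big_split /= big_distrr -!big_split /=.
  apply: eq_bigr => i _.
  by rewrite !addSn edge_layer3 //; have := ltn_ord i; rewrite /N; lia.
have := window_sum_down N l d.
have := window_sumS (up_edges N) l d; have := window_sumSr (up_edges N) l d.
have := window_sumS (binomial N) l d; have := window_sumSr (binomial N) l d.
have := window_sumS (up_edges N) l.+1 d; have := window_sumSr (up_edges N) l.+1 d.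
have := window_sumS (binomial N) l.+1 d; have := window_sumSr (binomial N) l.+1 d.
have := window_sumSr (up_edges N) l d.-1; have := window_sumSr (binomial N) l.+1 d.-1.
have := window_sumS (up_edges N) l.+1 d.-1; have := window_sumS (binomial N) l.+1 d.-1.
have := @up_edges_mirror l d d 0 (addn0 d).
have := @up_edges_mirror l d d.-1 1; have := @bin_mirror l d d 1 (addn1 d).
have := @bin_mirror l d d.+1 0 (addn0 _).
rewrite !addn0 !addn1 -dE -/N => cd1 cd /(_ erefl) ed1 ed.
have := up_edgesE N (l + d.-1); rewrite -addnS -dE => ed'.
have e0 : up_edges N l = ('C(N, l) * (l + d.+1))%N.
  by rewrite /up_edges /N; congr muln; lia.
have eD : up_edges N (l + d.+1) = (l * 'C(N, l))%N.
  by rewrite /up_edges cd1 mulnC; congr muln; rewrite /N; lia.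
have w1 h a : window_sum h a 1 = h a by rewrite /window_sum big_ord1 addn0.
have w0 h a : window_sum h a 0 = 0%N by rewrite /window_sum big_ord0.
rewrite !w0 !w1 !addSnnS !prednK ?(ltn_trans _ d3) //.
have : (d.-2 * 'C(N, l) + l * 'C(N, l) + 3 * 'C(N, l) = up_edges N l)%N.
  by rewrite e0 -!mulnDl mulnC; congr muln; lia.
move: ed ed' ed1 cd eD cd1; set e0' := up_edges N l; lia.
Qed.

(** * Polynomial functions on the cube *)

Definition polyfun (R : realType) (n d : nat) (g : cube n -> R) : Prop :=
  exists p : mpoly.mpoly n R,
    (mpoly.msize p <= d.+1)%N /\ forall x, g x = mpoly.meval (coord R x) p.

Lemma eq_polyfun (R : realType) (n d : nat) (g h : cube n -> R) :
  g =1 h -> polyfun d g -> polyfun d h.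
Proof. by move=> gh [p [sp pE]]; exists p; split => // x; rewrite -gh. Qed.

Lemma polyfunW (R : realType) (n d e : nat) (g : cube n -> R) :
  (d <= e)%N -> polyfun d g -> polyfun e g.
Proof. by move=> de [p [sp pE]]; exists p; split => //; lia. Qed.

Lemma polyfun_cst (R : realType) (n : nat) (c : R) :
  polyfun 0 (fun _ : cube n => c).
Proof.
exists (mpolyC n c); split; last by move=> x; rewrite mevalC.
by rewrite mmeasureC; case: eqP.
Qed.

Lemma polyfun_coord (R : realType) (n : nat) (i : 'I_n) :
  polyfun 1 (fun x : cube n => coord R x i).
Proof.
exists (mpolyX R (mnm1 i)); split; last by move=> x; rewrite mevalXU.
by rewrite msizeX mdeg1.
Qed.

Lemma polyfunD (R : realType) (n d : nat) (g h : cube n -> R) :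
  polyfun d g -> polyfun d h -> polyfun d (fun x => g x + h x).
Proof.
move=> [p [sp pE]] [q [sq qE]]; exists (p + q); split.
  by rewrite (leq_trans (mmeasureD_le _ _ _)) // geq_max sp.
by move=> x; rewrite mevalD pE qE.
Qed.

Lemma polyfunM (R : realType) (n d e : nat) (g h : cube n -> R) :
  polyfun d g -> polyfun e h -> polyfun (d + e) (fun x => g x * h x).
Proof.
move=> [p [sp pE]] [q [sq qE]]; exists (p * q); split.
  have [->|p0] := eqVneq p 0; first by rewrite mul0r mmeasure0.
  have [->|q0] := eqVneq q 0; first by rewrite mulr0 mmeasure0.
  rewrite msizeM // -subn1 leq_subLR; apply: (leq_trans (leq_add sp sq)); lia.
by move=> x; rewrite mevalM pE qE.
Qed.

Lemma polyfunZ (R : realType) (n d : nat) (c : R) (g : cube n -> R) :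
  polyfun d g -> polyfun d (fun x => c * g x).
Proof. by move=> pg; apply: (polyfunM (polyfun_cst _ c) pg). Qed.

Lemma polyfun_sum (R : realType) (n d : nat) (I : Type) (r : seq I)
    (P : pred I) (g : I -> cube n -> R) :
  (forall i, polyfun d (g i)) -> polyfun d (fun x => \sum_(i <- r | P i) g i x).
Proof.
move=> pg; elim: r => [|i r IH].
  apply: (@eq_polyfun _ _ _ (fun=> 0)) => [x|]; first by rewrite big_nil.
  exact: polyfunW (polyfun_cst _ _).
case Pi : (P i).
  apply: eq_polyfun (polyfunD (pg i) IH) => x; by rewrite big_cons Pi.
by apply: eq_polyfun IH => x; rewrite big_cons Pi.
Qed.

Lemma polyfun_prod (R : realType) (n : nat) (I : Type) (r : seq I)
    (g : I -> cube n -> R) :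
  (forall i, polyfun 1 (g i)) -> polyfun (size r) (fun x => \prod_(i <- r) g i x).
Proof.
move=> pg; elim: r => [|i r IH].
  apply: eq_polyfun (polyfun_cst _ 1) => x; by rewrite big_nil.
by apply: eq_polyfun (polyfunM (pg i) IH) => x; rewrite big_cons.
Qed.

Lemma bool_coord (R : realType) (n : nat) (x : cube n) (i : 'I_n) :
  (x i : nat)%:R = 2^-1 * (coord R x i + 1).
Proof. by rewrite /coord; case: (x i) => /=; lra. Qed.

Lemma polyfun_bit (R : realType) (n : nat) (i : 'I_n) :
  polyfun 1 (fun x : cube n => (x i : nat)%:R : R).
Proof.
apply: (@eq_polyfun _ _ _ (fun x => 2^-1 * (coord R x i + 1))).
  by move=> x; rewrite bool_coord.
apply: polyfunZ; apply: polyfunD; first exact: polyfun_coord.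
exact: polyfunW (polyfun_cst _ _).
Qed.

Lemma polyfun_ones_lo (R : realType) (m n : nat) :
  polyfun 1 (fun x : cube n => (ones_lo m x)%:R : R).
Proof.
apply: (@eq_polyfun _ _ _ (fun x => \sum_(i < n | (i < m)%N) (x i : nat)%:R)).
  by move=> x; rewrite /ones_lo natr_sum.
by apply: polyfun_sum => i; apply: polyfun_bit.
Qed.

Lemma polyfun_ones_hi (R : realType) (m n : nat) :
  polyfun 1 (fun x : cube n => (ones_hi m x)%:R : R).
Proof.
apply: (@eq_polyfun _ _ _ (fun x => \sum_(i < n | ~~ (i < m)%N) (x i : nat)%:R)).
  by move=> x; rewrite /ones_hi natr_sum.
by apply: polyfun_sum => i; apply: polyfun_bit.
Qed.

Lemma polyfun_prod_hi (R : realType) (m n : nat) (r : seq R) :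
  polyfun (size r) (fun x : cube n => \prod_(a <- r) ((ones_hi m x)%:R - a)).
Proof.
apply: polyfun_prod => a; apply: polyfunD; first exact: polyfun_ones_hi.
exact: polyfunW (polyfun_cst _ (- a)).
Qed.

(** * Realising the sign patterns by perturbed products *)

Lemma sg_perturb (R : realType) (T : finType) (p q : T -> R) :
  (forall x, p x != 0 -> 1 <= `|p x|) ->
  exists2 e : R, 0 < e &
    forall x, Num.sg (p x + e * q x) =
      if p x == 0 then Num.sg (q x) else Num.sg (p x).
Proof.
(* With the factor [B^-1] the perturbation stays below 1 in absolute value, so it decides the sign
   only at zeros of [p]. *)
move=> p1; pose B := 1 + \sum_x `|q x|.
have B0 : 0 < B by rewrite ltr_pwDl // sumr_ge0.
exists B^-1; rewrite ?invr_gt0 // => x.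
have qB : `|B^-1 * q x| < 1.
  rewrite normrM gtr0_norm ?invr_gt0 // mulrC ltr_pdivrMr // mul1r.
  rewrite /B (bigD1 x) //= addrCA ltrDl ltr_pwDl // sumr_ge0 //.
case: eqP => [->|/eqP px]; first by rewrite add0r sgrM gtr0_sg ?invr_gt0 // mul1r.
have := p1 _ px; move: qB; set v := B^-1 * q x; rewrite ltr_norml => /andP[v1 v2].
have [p0|p0] := ltP 0 (p x).
  by rewrite gtr0_norm // => ?; rewrite !gtr0_sg //; lra.
by rewrite ler0_norm // => ?; rewrite !ltr0_sg //; lra.
Qed.

Definition half_ints (R : realType) (b c : nat) : seq R :=
  [seq j%:R + 2^-1 | j <- iota b c].

Definition ints (R : realType) (b c : nat) : seq R := [seq j%:R | j <- iota b c].

Lemma half_ints_recl (R : realType) (b c : nat) :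
  half_ints R b c.+1 = (b%:R + 2^-1) :: half_ints R b.+1 c.
Proof. by []. Qed.

Lemma half_ints_recr (R : realType) (b c : nat) :
  half_ints R b c.+1 = rcons (half_ints R b c) ((b + c)%:R + 2^-1).
Proof. by rewrite /half_ints -(addn1 c) iotaD map_cat cats1. Qed.

(** The number of roots above [k] is [minn c (b + c - k)], the subtraction being truncated at 0. *)
Lemma sg_prod_half_ints (R : realType) (b c k : nat) :
  Num.sg (\prod_(a <- half_ints R b c) (k%:R - a)) =
    (-1) ^+ odd (minn c (b + c - k)).
Proof.
elim: c b => [|c IH] b; first by rewrite big_nil sgr1 min0n.
rewrite half_ints_recl big_cons sgrM IH.
have [kb|bk] := leqP k b.
  have kbR : k%:R <= b%:R :> R by rewrite ler_nat.
  rewrite ltr0_sg; last by lra.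
  have -> : minn c (b.+1 + c - k) = c by lia.
  have -> : minn c.+1 (b + c.+1 - k) = c.+1 by lia.
  by rewrite !signr_odd exprS.
have kbR : b%:R + 1 <= k%:R :> R by rewrite natr1 ler_nat.
rewrite gtr0_sg; last by lra.
by rewrite mul1r; congr (_ ^+ odd _); lia.
Qed.

(** Away from the roots each factor is a nonzero integer, whence the lower bound 1 that [sg_perturb]
    requires. *)
Lemma sg_prod_ints (R : realType) (b c k : nat) : ~~ (b <= k < b + c)%N ->
  Num.sg (\prod_(a <- ints R b c) (k%:R - a)) = (-1) ^+ odd (minn c (b + c - k)) /\
  1 <= `|\prod_(a <- ints R b c) (k%:R - a)|.
Proof.
elim: c b => [|c IH] b kbc; first by rewrite big_nil sgr1 normr1 min0n.
rewrite /ints /= big_cons -/(ints R b.+1 c) sgrM normrM.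
have [-> p1] : Num.sg (\prod_(a <- ints R b.+1 c) (k%:R - a)) =
    (-1) ^+ odd (minn c (b.+1 + c - k)) /\
    1 <= `|\prod_(a <- ints R b.+1 c) (k%:R - a)| by apply: IH; lia.
have [kb|bk] := leqP k b.
  have kbR : k%:R + 1 <= b%:R :> R by rewrite natr1 ler_nat; lia.
  split; last by rewrite mulr_ege1 // ltr0_norm; lra.
  rewrite ltr0_sg; last by lra.
  have -> : minn c (b.+1 + c - k) = c by lia.
  have -> : minn c.+1 (b + c.+1 - k) = c.+1 by lia.
  by rewrite !signr_odd exprS.
have kbR : b%:R + 1 <= k%:R :> R by rewrite natr1 ler_nat.
split; last by rewrite mulr_ege1 // gtr0_norm; lra.
rewrite gtr0_sg; last by lra.
by rewrite mul1r; congr (_ ^+ odd _); lia.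
Qed.

Lemma prod_ints_eq0 (R : realType) (b c k : nat) : (b <= k < b + c)%N ->
  \prod_(a <- ints R b c) (k%:R - a) = 0.
Proof.
move=> kbc; apply/eqP; rewrite prodf_seq_eq0; apply/hasP.
by exists k%:R; rewrite ?subrr ?eqxx //; apply: map_f; rewrite mem_iota.
Qed.

Lemma ones_lo_le (m N : nat) (x : cube (m + N)) : (ones_lo m x <= m)%N.
Proof.
rewrite -[leqRHS](card_lo m N) -sum1_card.
by apply: leq_sum => i _; case: (x i).
Qed.

(* [q] decides the signs on the layers where the leading part
   [(k - l - 1) ... (k - l - d)] vanishes. *)
Lemma PTF_of_layers (R : realType) (m N l d : nat) (q : nat -> nat -> R)
    (neg : nat -> nat -> bool) :
  polyfun d (fun x : cube (m + N) => q (ones_lo m x) (ones_hi m x)) ->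
  (forall a k, (a <= m)%N -> (l < k <= l + d)%N ->
    Num.sg (q a k) = (-1) ^+ neg a k) ->
  (forall a k, (k <= l)%N -> neg a k = odd d) ->
  (forall a k, (l + d < k)%N -> neg a k = false) ->
  PTF d (fun x : cube (m + N) =>
    (-1) ^+ neg (ones_lo m x) (ones_hi m x) : R).
Proof.
move=> pq qE lowE highE; split.
  by move=> x; case: (neg _ _); [right; rewrite expr1 | left].
pose p (x : cube (m + N)) : R := \prod_(a <- ints R l.+1 d) ((ones_hi m x)%:R - a).
have outside x : p x != 0 -> ~~ (l.+1 <= ones_hi m x < l.+1 + d)%N.
  by apply: contraNN => kin; rewrite /p prod_ints_eq0.
have [e e0 eE] := @sg_perturb R _ p
  (fun x => q (ones_lo m x) (ones_hi m x)) (fun x px => (sg_prod_ints R (outside x px)).2).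
have pp : polyfun d p.
  by rewrite -[X in polyfun X](size_iota l.+1) -(size_map (fun j => j%:R : R));
     apply: polyfun_prod_hi.
have [r [sr rE]] := polyfunD pp (polyfunZ e pq).
exists r; split => // x; rewrite -rE eE.
case: eqP => [p0|/eqP /outside pn0].
  rewrite qE ?ones_lo_le //; apply: contraT => pn0.
  have := (@sg_prod_ints R l.+1 d (ones_hi m x) _).2; rewrite -/(p x) p0 normr0.
  by rewrite ler10 => /(_ _)/negP; case; lia.
rewrite (sg_prod_ints R pn0).1; congr (_ ^+ (_ : bool)).
have [kl|lk] := leqP (ones_hi m x) l.
  by rewrite lowE //; congr odd; lia.
by rewrite highE; [apply/esym/negbTE; rewrite (_ : minn _ _ = 0%N) //; lia | lia].
Qed.

Definition half_prod (R : realType) (b c k : nat) : R :=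
  \prod_(a <- half_ints R b c) (k%:R - a).

Lemma half_prod_recl (R : realType) (b c k : nat) :
  half_prod R b c.+1 k = (k%:R - b%:R - 2^-1) * half_prod R b.+1 c k.
Proof. by rewrite /half_prod half_ints_recl big_cons opprD addrA. Qed.

Lemma half_prod_recr (R : realType) (b c k : nat) :
  half_prod R b c.+1 k = (k%:R - (b + c)%:R - 2^-1) * half_prod R b c k.
Proof. by rewrite /half_prod half_ints_recr -cats1 big_cat big_seq1 mulrC opprD addrA. Qed.

Lemma polyfun_half_prod (R : realType) (m n b c : nat) :
  polyfun c (fun x : cube n => half_prod R b c (ones_hi m x)).
Proof.
have := @polyfun_prod_hi R m n (half_ints R b c).
by rewrite size_map size_iota.
Qed.

Lemma ones_lo2 (N : nat) (x : cube (2 + N)) :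
  ones_lo 2 x = (x ord0 + x (lift ord0 ord0))%N.
Proof.
rewrite /ones_lo big_mkcond (@big_ord_recl _ _ _ N.+1) (@big_ord_recl _ _ _ N) /=.
by rewrite big1 // addn0.
Qed.

Lemma ones_lo3 (N : nat) (x : cube (3 + N)) :
  ones_lo 3 x = (x ord0 + (x (lift ord0 ord0) + x (lift ord0 (lift ord0 ord0))))%N.
Proof.
rewrite /ones_lo big_mkcond (@big_ord_recl _ _ _ N.+2) (@big_ord_recl _ _ _ N.+1).
by rewrite (@big_ord_recl _ _ _ N) /= big1 // addn0.
Qed.

(** The [d - 1] half-integer roots separate the layers [l + 1] to [l + d], with [l + d - k] of them
    above [k]; negation stands for one more root above. *)
Lemma sg_interpolant (R : realType) (l d k : nat) : (3 <= d)%N ->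
  (l < k <= l + d)%N ->
  Num.sg (half_prod R l.+1 d.-1 k) = (-1) ^+ neg_below l d k /\
  Num.sg (- half_prod R l.+1 d.-1 k) = (-1) ^+ neg_above l d k.
Proof.
move=> d3 lk; rewrite sgrN /half_prod sg_prod_half_ints -signrN.
by split; congr (_ ^+ nat_of_bool _); rewrite /neg_below /neg_above; lia.
Qed.

(* Since [half_prod (l+1) (d-1)] is [k - l - 3/2] times
   [half_prod (l+2) (d-2)], the weight [3 d] makes the latter dominate. *)
Lemma sg_top_slice (R : realType) (l d k : nat) : (3 <= d)%N ->
  (l < k <= l + d)%N ->
  Num.sg (half_prod R l.+1 d.-1 k * 3 - (3 * d)%:R * half_prod R l.+2 d.-2 k) =
  (-1) ^+ neg_above_but_first l d k.
Proof.
move=> d3 lk.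
have kR : k%:R <= l%:R + d%:R :> R by rewrite -natrD ler_nat; lia.
have lR : l.+1%:R = l%:R + 1 :> R by rewrite natr1.
rewrite (_ : d.-1 = d.-2.+1); last by lia.
rewrite half_prod_recl lR natrM.
set h := half_prod _ _ _ _.
have -> : (k%:R - (l%:R + 1) - 2^-1) * h * 3 - 3%:R * d%:R * h =
    (3 * d%:R - 3 * (k%:R - l%:R) + 9 / 2) * - h by field.
rewrite sgrM gtr0_sg; last by lra.
rewrite mul1r sgrN /h /half_prod sg_prod_half_ints -signrN.
by congr (_ ^+ nat_of_bool _); rewrite /neg_above_but_first; do ?case: ifP; lia.
Qed.

(** Mirror image of [sg_top_slice]: the last root [l + d - 1/2] is split off, and the weight [3 d]
    leaves the positive factor [3 (k - l) + 3/2] in front of [- h]. *)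
Lemma sg_bottom_slice (R : realType) (l d k : nat) : (3 <= d)%N ->
  (l < k <= l + d)%N ->
  Num.sg (- (half_prod R l.+1 d.-1 k * 3) - (3 * d)%:R * half_prod R l.+1 d.-2 k) =
  (-1) ^+ neg_below_but_last l d k.
Proof.
move=> d3 lk.
have kR : l%:R + 1 <= k%:R :> R by rewrite natr1 ler_nat; lia.
have dR : (l.+1 + d.-2)%:R = l%:R + d%:R - 1 :> R.
  by rewrite -natrD (_ : l + d = (l.+1 + d.-2).+1)%N ?mulrSr ?addrK //; lia.
rewrite (_ : d.-1 = d.-2.+1); last by lia.
rewrite half_prod_recr dR natrM.
set h := half_prod _ _ _ _.
have -> : - ((k%:R - (l%:R + d%:R - 1) - 2^-1) * h * 3) - 3%:R * d%:R * h =
    (3 * (k%:R - l%:R) + 3 / 2) * - h by field.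
rewrite sgrM gtr0_sg; last by lra.
rewrite mul1r sgrN /h /half_prod sg_prod_half_ints -signrN.
by congr (_ ^+ nat_of_bool _); rewrite /neg_below_but_last; do ?case: ifP; lia.
Qed.

(** The factor [2 a - 1] is -1, 1, 3 on the slices, which settles the first two. Slice 2 is
    corrected through its indicator, the product of the first two bits, which leaves degree [d - 2]
    for the other factor. *)
Lemma PTF_neg2 (R : realType) (l d N : nat) : (3 <= d)%N ->
  PTF d (fun x : cube (2 + N) =>
    (-1) ^+ neg2 l d (ones_lo 2 x) (ones_hi 2 x) : R).
Proof.
move=> d3; pose q (a k : nat) : R := half_prod R l.+1 d.-1 k * (2 * a%:R - 1) -
  (3 * d)%:R * half_prod R l.+2 d.-2 k * (a == 2)%:R.
apply: (@PTF_of_layers R 2 N l d q (neg2 l d)).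
- apply: (@eq_polyfun _ _ _ (fun x =>
    half_prod R l.+1 d.-1 (ones_hi 2 x) * (2 * (ones_lo 2 x)%:R + -1) +
    (- (3 * d)%:R) * (half_prod R l.+2 d.-2 (ones_hi 2 x) *
      ((x ord0 : nat)%:R * (x (lift ord0 ord0) : nat)%:R)))).
    move=> x; rewrite /q mulNr; congr (_ - _); rewrite -mulrA; congr (_ * (_ * _)).
    rewrite ones_lo2.
    by case: (x ord0); case: (x (lift _ _)); rewrite /= ?mulr1 ?mulr0.
  apply: polyfunD.
    apply: (@polyfunW _ _ (d.-1 + 1)); first by lia.
    apply: polyfunM; first exact: polyfun_half_prod.
    apply: polyfunD; first exact: polyfunZ (polyfun_ones_lo _ _ _).
    exact: polyfunW (polyfun_cst _ _).
  apply: (@polyfunW _ _ (d.-2 + (1 + 1))); first by lia.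
  apply: polyfunZ; apply: polyfunM; first exact: polyfun_half_prod.
  by apply: polyfunM; apply: polyfun_bit.
- move=> a k a2 lk; have [sb sa] := sg_interpolant R d3 lk.
  case: a a2 => [|[|[|//]]] _; rewrite /q /=.
  + by rewrite mulr0 sub0r mulrN1 mulr0 subr0.
  + by rewrite mulr0 subr0 (_ : 2 * 1 - 1 = 1 :> R) ?mulr1 //; lra.
  + by rewrite mulr1 (_ : 2 * 2%:R - 1 = 3 :> R) ?sg_top_slice //; lra.
- by case=> [|[|a]] k kl; rewrite /neg2 /neg_above /neg_below
    /neg_above_but_first ?kl //; congr odd; lia.
- by case=> [|[|a]] k lk; rewrite /neg2 /neg_above /neg_below
    /neg_above_but_first; do ?case: ifP; lia.
Qed.

(** The factor [2 a - 3] is -3, -1, 1, 3, which settles the middle slices; the extreme ones are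
    corrected through their indicators. *)
Lemma PTF_neg3 (R : realType) (l d N : nat) : (3 <= d)%N ->
  PTF d (fun x : cube (3 + N) =>
    (-1) ^+ neg3 l d (ones_lo 3 x) (ones_hi 3 x) : R).
Proof.
move=> d3; pose q (a k : nat) : R := half_prod R l.+1 d.-1 k * (2 * a%:R - 3) -
  (3 * d)%:R * (half_prod R l.+2 d.-2 k * (a == 3)%:R +
                half_prod R l.+1 d.-2 k * (a == 0)%:R).
apply: (@PTF_of_layers R 3 N l d q (neg3 l d)).
- pose z0 (x : cube (3 + N)) : R := (x ord0 : nat)%:R.
  pose z1 (x : cube (3 + N)) : R := (x (lift ord0 ord0) : nat)%:R.
  pose z2 (x : cube (3 + N)) : R := (x (lift ord0 (lift ord0 ord0)) : nat)%:R.
  have pz0 : polyfun 1 z0 by exact: polyfun_bit.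
  have pz1 : polyfun 1 z1 by exact: polyfun_bit.
  have pz2 : polyfun 1 z2 by exact: polyfun_bit.
  have pc (c : R) e : polyfun e (fun _ : cube (3 + N) => c).
    exact: polyfunW (polyfun_cst _ c).
  (* The two cubic bumps carry factors of degree d-2 with equal leading
     coefficients, so the coefficient of [z0 z1 z2] has degree d-3 only. *)
  apply: (@eq_polyfun _ _ _ (fun x =>
    half_prod R l.+1 d.-1 (ones_hi 3 x) * (2 * (ones_lo 3 x)%:R + -3) +
    (- (3 * d)%:R) *
     (half_prod R l.+2 (d - 3) (ones_hi 3 x) *
        ((2 - d%:R) * (z0 x * (z1 x * z2 x))) +
      half_prod R l.+1 d.-2 (ones_hi 3 x) *
        (1 + (-1) * (z0 x + (z1 x + z2 x)) +
         (z0 x * z1 x + (z0 x * z2 x + z1 x * z2 x)))))).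
    move=> x; rewrite /q mulNr; congr (_ - _ * _).
    (* The two products share [d - 3] roots, and their remaining roots differ by [d - 2]. *)
    have -> : half_prod R l.+2 d.-2 (ones_hi 3 x) =
        half_prod R l.+1 d.-2 (ones_hi 3 x) +
        (2 - d%:R) * half_prod R l.+2 (d - 3) (ones_hi 3 x).
      rewrite (_ : d.-2 = (d - 3).+1); last by lia.
      rewrite (half_prod_recr _ l.+2) (half_prod_recl _ l.+1).
      have -> : (l.+2 + (d - 3))%:R = l%:R + d%:R - 1 :> R.
        by rewrite -natrD (_ : l + d = (l.+2 + (d - 3)).+1)%N ?mulrSr ?addrK //; lia.
      have -> : l.+1%:R = l%:R + 1 :> R by rewrite natr1.
      by ring.
    rewrite ones_lo3 /z0 /z1 /z2.
    by case: (x ord0); do 2!case: (x (lift _ _)); rewrite /=; ring.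
  apply: polyfunD.
    apply: (@polyfunW _ _ (d.-1 + 1)); first by lia.
    apply: polyfunM; first exact: polyfun_half_prod.
    by apply: polyfunD => //; apply: polyfunZ; apply: polyfun_ones_lo.
  apply: polyfunZ; apply: polyfunD.
    apply: (@polyfunW _ _ ((d - 3) + (1 + (1 + 1)))); first by lia.
    apply: polyfunM; first exact: polyfun_half_prod.
    by apply: polyfunZ; apply: polyfunM => //; apply: polyfunM.
  apply: (@polyfunW _ _ (d.-2 + (1 + 1))); first by lia.
  apply: polyfunM; first exact: polyfun_half_prod.
  apply: polyfunD.
    apply: polyfunD => //; apply: polyfunZ; apply: (@polyfunW _ _ 1) => //.
    by do 2!apply: polyfunD => //.
  by apply: polyfunD; [|apply: polyfunD]; apply: polyfunM.
- move=> a k a2 lk; have [sb sa] := sg_interpolant R d3 lk.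
  case: a a2 => [|[|[|[|//]]]] _; rewrite /q /=.
  + by rewrite !mulr0 sub0r add0r mulr1 mulrN sg_bottom_slice.
  + by rewrite !mulr0 addr0 mulr0 subr0 (_ : 2 * 1 - 3 = -1 :> R) ?mulrN1 //; lra.
  + by rewrite !mulr0 addr0 mulr0 subr0 (_ : 2 * 2%:R - 3 = 1 :> R) ?mulr1 //; lra.
  + by rewrite mulr0 addr0 mulr1 (_ : 2 * 3%:R - 3 = 3 :> R) ?sg_top_slice //; lra.
- case=> [|[|[|a]]] k kl; rewrite /neg3 /neg_above /neg_below /neg_above_but_first
    /neg_below_but_last ?kl //; do ?case: ifP; lia.
- case=> [|[|[|a]]] k lk; rewrite /neg3 /neg_above /neg_below /neg_above_but_first
    /neg_below_but_last; do ?case: ifP; lia.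
Qed.

(** * Gaussian lower bound on binomials *)

Lemma expR_ge_pow (R : realType) (x : R) (n : nat) : (0 < n)%N -> 0 <= x ->
  (1 + x / n%:R) ^+ n <= expR x.
Proof.
move=> n0 x0; rewrite -[x in leRHS](@divfK _ n%:R) ?pnatr_eq0 -?lt0n //.
rewrite expRM_natr lerXn2r ?nnegrE ?expR_ge0 ?expR_ge1Dx //.
by rewrite addr_ge0 ?divr_ge0 ?ler0n.
Qed.

(** Here [(1 + w) / (1 - w)] stands for the ratio of consecutive binomials. The exponential is at
    least [(1 + w / 2) ^+ 8], whose terms up to degree 4 suffice for [w] up to [43 / 50]. *)
Lemma expR_step (R : realType) (w : R) : 0 <= w -> w <= 43 / 50 ->
  1 + w <= (1 - w) * expR (4 * w).
Proof.
move=> w0 w1; have v0 : 0 <= w / 2 by lra.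
have e8 : (1 + w / 2) ^+ 8 <= expR (4 * w).
  have := @expR_ge_pow R (4 * w) 8 isT; rewrite (_ : 4 * w / 8%:R = w / 2).
    by apply; lra.
  by lra.
move: e8; set v := w / 2 => e8; have wE : w = 2 * v by rewrite /v; lra.
have v1 : v <= 43 / 100 by lra.
rewrite wE in e8 *; apply: le_trans (ler_wpM2l _ e8); last by lra.
have v2 : 0 <= v ^+ 2 by apply: exprn_ge0.
have v3 : 0 <= v ^+ 3 by apply: exprn_ge0.
have v4 : 0 <= v ^+ 4 by apply: exprn_ge0.
have v2' : v ^+ 2 <= 43 / 100 * v by rewrite expr2 ler_wpM2r.
have v3' : v ^+ 3 <= 43 / 100 * v ^+ 2 by rewrite exprS ler_wpM2r.
have v4' : v ^+ 4 <= 43 / 100 * v ^+ 3 by rewrite exprS ler_wpM2r.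
have trunc : 1 + 8 * v + 28 * v ^+ 2 + 56 * v ^+ 3 + 70 * v ^+ 4 <= (1 + v) ^+ 8.
  have -> : (1 + v) ^+ 8 = 1 + 8 * v + 28 * v ^+ 2 + 56 * v ^+ 3 + 70 * v ^+ 4 +
    v ^+ 4 * (56 * v + 28 * v ^+ 2 + 8 * v ^+ 3 + v ^+ 4) by ring.
  by rewrite lerDl mulr_ge0 //; lra.
apply: le_trans (ler_wpM2l _ trunc); last by lra.
have -> : (1 - 2 * v) * (1 + 8 * v + 28 * v ^+ 2 + 56 * v ^+ 3 + 70 * v ^+ 4) =
    1 + 2 * v + v * (4 + 12 * v - 42 * v ^+ 3 - 140 * v ^+ 4) by ring.
by rewrite lerDl mulr_ge0 //; lra.
Qed.

Lemma leq_bin_pow2 (n m : nat) : ('C(n, m) <= 2 ^ n)%N.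
Proof.
elim: n m => [|n IH] [|m] //; first by rewrite bin0 expn_gt0.
by rewrite binS expnS mul2n -addnn leq_add.
Qed.

Lemma leq_bin_mid (N k : nat) : ('C(N, k) <= 'C(N, N./2))%N.
Proof.
have [kN|kN] := leqP k N./2; first by apply: leq_bin_center; lia.
have [kN'|kN'] := leqP k N; last by rewrite bin_small.
by rewrite -(@bin_sub N k) //; apply: leq_bin_center; lia.
Qed.

(* Going one layer away from the middle, the binomial shrinks by at most the
   Gaussian factor as long as N - 2l < 0.86 N; beyond that, the Gaussian factor
   already exceeds 2^N. *)
Lemma bin_gauss (R : realType) (N l : nat) : (0 < N)%N -> (l.*2 <= N)%N ->
  'C(N, N./2)%:R <= 'C(N, l)%:R * expR ((N%:R - l%:R *+ 2) ^+ 2 / N%:R) :> R.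
Proof.
move=> N0; have NR : 0 < N%:R :> R by rewrite ltr0n.
have [k kE] : exists k, k = (N./2 - l)%N by exists (N./2 - l)%N.
elim: k l kE => [|k IH] l kE lN.
  have -> : N./2 = l by lia.
  rewrite ler_peMr ?ler0n // -expR0 ler_expR divr_ge0 ?ler0n //.
  exact: sqr_ge0.
have lR : l%:R *+ 2 + 2 <= N%:R :> R.
  by rewrite -mulr_natr -natrM -natrD ler_nat; lia.
have l0 : 0 <= l%:R :> R by [].
set u : R := N%:R - l%:R *+ 2; have u2 : 2 <= u by rewrite /u; lra.
have [far|near] := leP (43 / 50 * N%:R) u.
  have c1 : 1 <= 'C(N, l)%:R :> R by rewrite ler1n bin_gt0; lia.
  apply: le_trans (ler_peMl (expR_ge0 _) c1).
  apply: (@le_trans _ _ (2 ^+ N)).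
    by rewrite -natrX ler_nat leq_bin_pow2.
  (* [7396 / 10000] is the square of [43 / 50] and exceeds the logarithm of 2. *)
  have e2 : 2 <= expR (7396 / 10000) :> R.
    apply: le_trans (@expR_ge_pow R (7396 / 10000) 8 isT _); last by lra.
    by lra.
  apply: (@le_trans _ _ (expR (7396 / 10000 * N%:R))).
    by rewrite expRM_natr lerXn2r ?nnegrE ?expR_ge0.
  rewrite ler_expR ler_pdivlMr // -mulrA.
  have : (43 / 50 * N%:R) ^+ 2 <= u ^+ 2 by rewrite lerXn2r ?nnegrE; lra.
  by rewrite exprMn !expr2; lra.
have := IH l.+1; rewrite -/u.
have -> : N%:R - l.+1%:R *+ 2 = u - 2 :> R by rewrite /u -natr1; lra.
move=> /(_ _ _)/le_trans; apply; [by lia | by lia |].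
(* For this [w] the ratio of ['C(N, l.+1)] to ['C(N, l)] is [(1 + w) / (1 - w)]. *)
pose w := (u - 1) / (N%:R + 1); have N1 : 0 < N%:R + 1 :> R by lra.
have w0 : 0 <= w by apply: divr_ge0; lra.
have w1 : w <= 43 / 50 by rewrite ler_pdivrMr //; lra.
have step : 'C(N, l.+1)%:R * (1 - w) = 'C(N, l)%:R * (1 + w) :> R.
  have := congr1 (fun j => j%:R : R) (mul_bin_left N l).
  rewrite /= !natrM natrB; last by lia.
  rewrite -natr1 => binE.
  have -> : 1 - w = 2 / (N%:R + 1) * (l%:R + 1) by rewrite /w /u; field; lra.
  have -> : 1 + w = 2 / (N%:R + 1) * (N%:R - l%:R) by rewrite /w /u; field; lra.
  by rewrite ![_ * (2 / _ * _)]mulrCA ![_%:R * (_ - _)]mulrC -binE mulrC; ring.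
have cle : 'C(N, l.+1)%:R <= 'C(N, l)%:R * expR (4 * w) :> R.
  rewrite -(ler_pM2r (_ : 0 < 1 - w)); last by lra.
  rewrite step -mulrA ler_wpM2l ?ler0n // [leRHS]mulrC; exact: expR_step.
apply: le_trans (ler_wpM2r (expR_ge0 _) cle) _.
rewrite -mulrA -expRD ler_wpM2l ?ler0n // ler_expR.
(* One step outwards raises the Gaussian exponent by [4 (u - 1) / N], which is at least [4 w]. *)
have -> : u ^+ 2 / N%:R = 4 * ((u - 1) / N%:R) + (u - 2) ^+ 2 / N%:R.
  by field; lra.
rewrite lerD2r ler_wpM2l // /w ler_wpM2l; [by [] | by lra |].
by rewrite lef_pV2 ?posrE; lra.
Qed.

(** * Comparison with f* and conclusion *)

Lemma relative_gain (R : realType) (l d n B gain : nat) : (0 < d)%N ->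
  (l.*2 + d.+1 <= n <= l.*2 + d.+4)%N ->
  (B <= n * (d * (4 * 'C(l.*2 + d.+1, (l.*2 + d.+1)./2))))%N ->
  (d * 'C(l.*2 + d.+1, l) <= 3 * gain)%N ->
  expR (-5) / 12 * n%:R^-1 * expR (- (d%:R ^+ 2 / n%:R)) * B%:R <= gain%:R :> R.
Proof.
set N := (l.*2 + d.+1)%N => d0 /andP[Nn nN] Ble dgain.
have d0R : 0 < d%:R :> R by rewrite ltr0n.
have NR : d%:R + 1 <= N%:R :> R by rewrite natr1 ler_nat /N; lia.
have NnR : N%:R <= n%:R :> R by rewrite ler_nat.
have nNR : n%:R <= N%:R + 3 :> R by rewrite -natrD ler_nat; lia.
have n0R : 0 < n%:R :> R by lra.
have gauss : expR (-5) * expR (- (d%:R ^+ 2 / n%:R)) * 'C(N, N./2)%:R <=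
    'C(N, l)%:R :> R.
  have := @bin_gauss R N l; rewrite {1}/N addnS => /(_ isT) /(_ _) bg.
  have {bg} := bg ltac:(rewrite /N; lia).
  have -> : N%:R - l%:R *+ 2 = d%:R + 1 :> R.
    by rewrite /N natrD -muln2 natrM mulr_natr natr1 addrAC subrr add0r.
  move=> bg; rewrite -expRD.
  apply: (@le_trans _ _ (expR (- ((d%:R + 1) ^+ 2 / N%:R)) * 'C(N, N./2)%:R)).
    rewrite ler_wpM2r ?ler0n // ler_expR -opprD lerN2.
    (* Passing from [(d + 1)^2 / N] to [d^2 / (N + 3)] costs at most [2 + 3], because
       [d + 1 <= N]. *)
    apply: (@le_trans _ _ (5 + d%:R ^+ 2 / (N%:R + 3))); last first.
      by rewrite lerD2l ler_wpM2l ?sqr_ge0 // lef_pV2 ?posrE; lra.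
    rewrite ler_pdivrMr; last by lra.
    rewrite -(ler_pM2r (_ : 0 < N%:R + 3 :> R)); last by lra.
    have -> : (5 + d%:R ^+ 2 / (N%:R + 3)) * N%:R * (N%:R + 3) =
      5 * N%:R * (N%:R + 3) + d%:R ^+ 2 * N%:R :> R by field; lra.
    by nra.
  by rewrite expRN mulrC ler_pdivrMr ?expR_gt0.
apply: (@le_trans _ _ (expR (-5) / 12 * n%:R^-1 * expR (- (d%:R ^+ 2 / n%:R)) *
    (n%:R * (d%:R * (4 * 'C(N, N./2)%:R))))).
  apply: ler_wpM2l.
    by rewrite !mulr_ge0 ?expR_ge0 ?invr_ge0 ?ler0n.
  by rewrite -!natrM ler_nat.
(* The 12 combines the 4 in the bound on [B] with the 3 in the bound on [gain]. *)
have -> : expR (-5) / 12 * n%:R^-1 * expR (- (d%:R ^+ 2 / n%:R)) *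
    (n%:R * (d%:R * (4 * 'C(N, N./2)%:R))) =
    d%:R / 3 * (expR (-5) * expR (- (d%:R ^+ 2 / n%:R)) * 'C(N, N./2)%:R) :> R.
  by field; lra.
apply: le_trans (ler_wpM2l _ gauss) _; first by lra.
have : (d * 'C(N, l))%:R <= (3 * gain)%:R :> R by rewrite ler_nat.
by rewrite !natrM; lra.
Qed.

Lemma HSF_with_gain (R : realType) (l d n B gain : nat) (f : cube n -> R) :
  (0 < d)%N -> (0 < gain)%N -> (l.*2 + d.+1 <= n <= l.*2 + d.+4)%N ->
  PTF d f -> dichromatic f = (B + gain)%N ->
  (B <= n * (d * (4 * 'C(l.*2 + d.+1, (l.*2 + d.+1)./2))))%N ->
  (d * 'C(l.*2 + d.+1, l) <= 3 * gain)%N ->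
  (forall s, closest_roots n d s -> (dichromatic (@fstar R n s) <= B)%N) ->
  HSF d f /\
  forall s : seq int, closest_roots n d s ->
    (1 + expR (-5) / 12 * n%:R^-1 * expR (- (d%:R ^+ 2 / n%:R)))
      * (dichromatic (@fstar R n s))%:R
    <= (dichromatic f)%:R :> R.
Proof.
move=> d0 g0 nN pf fE BC dg sB; split.
  by split=> // s /sB sle; rewrite fE; lia.
move=> s /sB sle; rewrite fE natrD.
apply: (@le_trans _ _ ((1 + expR (-5) / 12 * n%:R^-1 *
    expR (- (d%:R ^+ 2 / n%:R))) * B%:R)).
  apply: ler_wpM2l; last by rewrite ler_nat.
  by rewrite addr_ge0 // !mulr_ge0 ?expR_ge0 ?invr_ge0 ?ler0n.
by rewrite mulrDl mul1r lerD2l; apply: relative_gain nN BC dg.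
Qed.

(** Pascal's rule gives the factor 2; the 4 matches the case of two added rows, so that one constant
    serves both parities. *)
Lemma window_bin_le2 (N d a : nat) :
  (\sum_(i < d) 'C(N.+1, a.+1 + i) <= d * (4 * 'C(N, N./2)))%N.
Proof.
rewrite -[X in (_ <= X * _)%N]card_ord -sum_nat_const; apply: leq_sum => i _.
rewrite addSn binS; have := leq_bin_mid N (a + i).+1.
by have := leq_bin_mid N (a + i); lia.
Qed.

Lemma window_bin_le3 (N d a : nat) :
  (\sum_(i < d) 'C(N.+2, a.+2 + i) <= d * (4 * 'C(N, N./2)))%N.
Proof.
rewrite -[X in (_ <= X * _)%N]card_ord -sum_nat_const; apply: leq_sum => i _.
rewrite !addSn !binS; have := leq_bin_mid N (a + i).+2.
by have := leq_bin_mid N (a + i).+1; have := leq_bin_mid N (a + i); lia.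
Qed.

Theorem mainTheorem4 (R : realType) :
  exists c : R, 0 < c /\
  forall n d : nat, (7 <= n)%N -> (3 <= d)%N -> (d <= n - 3)%N ->
  exists f : cube n -> R,
    HSF d f /\
    forall s : seq int, closest_roots n d s ->
      (1 + c * n%:R^-1 * expR (- (d%:R ^+ 2 / n%:R)))
        * (dichromatic (@fstar R n s))%:R
      <= (dichromatic f)%:R.
Proof.
exists (expR (-5) / 12); split; first by rewrite divr_gt0 ?expR_gt0.
move=> n d n7 d3 dn.
(* Since [n - d] is at least 3, and at least 4 when even, [l] is a natural number. *)
have [[l nE]|[l nE]] : (exists l, n = 2 + (l.*2 + d.+1))%N \/
    (exists l, n = 3 + (l.*2 + d.+1))%N.
- have [od|ev] := boolP (odd (n - d)).
    by left; exists ((n - d - 3)./2); lia.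
  by right; exists ((n - d - 4)./2); lia.
- subst n; have c0 : (0 < 'C(l.*2 + d.+1, l))%N by rewrite bin_gt0; lia.
  exists (fun x => (-1) ^+ neg2 l d (ones_lo 2 x) (ones_hi 2 x)).
  apply: (HSF_with_gain (l := l) _ _ _ (PTF_neg2 R l _ d3)
    (dichromatic_neg2 d3 (fun=> erefl))).
  + by lia.
  + by rewrite muln_gt0 c0 andbT; lia.
  + by lia.
  + by rewrite leq_mul2l window_bin_le2 orbT.
  + by rewrite mulnA leq_mul2r; lia.
  + by move=> s sr; apply: dichromatic_fstar_le sr _ _; lia.
- subst n; have c0 : (0 < 'C(l.*2 + d.+1, l))%N by rewrite bin_gt0; lia.
  exists (fun x => (-1) ^+ neg3 l d (ones_lo 3 x) (ones_hi 3 x)).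
  apply: (HSF_with_gain (l := l) _ _ _ (PTF_neg3 R l _ d3)
    (dichromatic_neg3 d3 (fun=> erefl))).
  + by lia.
  + by rewrite muln_gt0 c0 andbT; lia.
  + by lia.
  + by rewrite leq_mul2l window_bin_le3 orbT.
  + by rewrite !mulnA leq_mul2r; lia.
  + by move=> s sr; apply: dichromatic_fstar_le sr _ _; lia.
Qed.
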